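(* Let $G$ be a group, $\mathsf V=\mathsf{Al}(T,\Sigma)$ a variety of algebras, and $(\theta,\mathcal A)\in\mathsf{pA}(G,\mathsf V)$. There exists a globalization of $(\theta,\mathcal A)$ in $\mathsf A(G,\mathsf V)$ if and only if the amalgam $\mathbf A(\theta,\mathcal A)$ is embeddable into a $\mathsf V$-algebra.
   Context: Partial actions. A partial action of a group $G$ on a set $A$ is a partial map $\theta:G\times A\dashrightarrow A$ such that for all $x,y\in G$, $a\in A$: (i) $\theta(1,a)$ is defined and equals $a$; (ii) if $\theta(x,a)$ is defined, then $\theta(x^{-1},\theta(x,a))$ is defined and equals $a$; (iii) if $\theta(y,a)$ and $\theta(x,\theta(y,a))$ are defined, then $\theta(xy,a)$ is defined and equals $\theta(x,\theta(y,a))$. It is global if everywhere defined. One writes $xa$ for $\theta(x,a)$ and $xa\neq\varnothing$ for ''$xa$ is defined''. The domain $D_x$ is $\{\theta(x,a)\mid a\in A,\ \theta(x,a)\text{ defined}\}$, and $\theta_x=\theta(x,-)$ is a bijection $D_{x^{-1}}\to D_x$. A type of algebras is a sequence $T=\{n_\gamma\}_{\gamma<o(T)}$ of non-negative integers indexed by ordinals (arities). $\mathsf V=\mathsf{Al}(T,\Sigma)$ is the class of (total) algebras of type $T$ satisfying all identities of the set $\Sigma$. $\mathsf{pA}(G,\mathsf V)$ is the category of pairs $(\theta,\mathcal A)$ with $\mathcal A\in\mathsf V$ and $\theta$ a partial action of $G$ on the set $A$ such that every $D_x$ is a subalgebra $\mathcal D_x$ of $\mathcal A$ and every $\theta_x:\mathcal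 D_{x^{-1}}\to\mathcal D_x$ is an isomorphism. Morphisms $(\theta,\mathcal A)\to(\theta',\mathcal A')$ are homomorphisms $\varphi$ such that whenever $\theta(x,a)$ is defined, $\theta'(x,\varphi(a))$ is defined and equals $\varphi(\theta(x,a))$. $\mathsf A(G,\mathsf V)$ is the full subcategory of pairs with global $\theta$. A globalization of $(\theta,\mathcal A)$ in $\mathsf A(G,\mathsf V)$ is $(\vartheta,\mathcal B)\in\mathsf A(G,\mathsf V)$ with an injective morphism $\iota:(\theta,\mathcal A)\to(\vartheta,\mathcal B)$ such that $xa\neq\varnothing\iff x\iota(a)\in\iota(A)$ for all $x\in G$, $a\in A$. Amalgams. A (generalized) amalgam of $\mathsf V$-algebras is a triple $\mathbf A=[\{\mathcal A_i\}_{i\in I},\{\mathcal A_{ij}\}_{i,j\in I},\{\alpha_{ij}\}_{i,j\in I}]$, where $\mathcal A_i\in\mathsf V$, $\mathcal A_{ij}$ is a subalgebra of $\mathcal A_i$ and $\alpha_{ij}:\mathcal A_{ij}\to\mathcal A_{ji}$ is an isomorphism with $\alpha_{ji}=\alpha_{ij}^{-1}$, $i,j\in I$ (with $A_{ii}=A_i$ and $\alpha_{ii}=\mathrm{id}$). It is embeddable into $\mathcal C\in\mathsf V$ if there exist injective homomorphisms $\varphi_i:\mathcal A_i\to\mathcal C$ such that $\varphi_j\circ\alpha_{ij}=\varphi_i|_{A_{ij}}$ and $\varphi_i(A_i)\cap\varphi_j(A_j)=\varphi_i(A_{ij})$ for all $i,j\in I$. The amalgam associated with $(\theta,\mathcal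 A)$ is $\mathbf A(\theta,\mathcal A)=[\{\mathcal A_x\}_{x\in G},\{\mathcal A_{x,y}\}_{x,y\in G},\{\alpha_{x,y}\}_{x,y\in G}]$, where $\mathcal A_x$ is a copy of $\mathcal A$, $\mathcal A_{x,y}=\mathcal D_{x^{-1}y}$ (inside the copy $\mathcal A_x$) and $\alpha_{x,y}=\theta_{y^{-1}x}$ (as a map $\mathcal A_{x,y}\to\mathcal A_{y,x}$) for all $x,y\in G$. *)

(* Defs.v *)
From mathcomp Require Import all_boot.
From mathcomp Require Import boolp classical_sets.

Set Implicit Arguments.
Unset Strict Implicit.
Unset Printing Implicit Defensive.

Local Open Scope classical_set_scope.
Local Open Scope group_scope.

Lemma sval_inj (A : Type) (S : set A) : injective (@proj1_sig A S).
Proof.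
by case=> a Sa [b Sb] /= ab; subst b; rewrite (Prop_irrelevance Sa Sb).
Qed.

(* The operation symbols are indexed by an arbitrary type instead of the
   ordinals below o(T); the well-order on the indices plays no role. *)
Record alg_type := AlgType { symb : Type; arity : symb -> nat }.

(* Carriers may be empty: an empty domain D_x is a legitimate subalgebra when
   there are no nullary operations. *)
Record algebra (T : alg_type) := Algebra {
  carrier :> Type;
  oper : forall f : symb T, ('I_(arity f) -> carrier) -> carrier }.

Inductive term (T : alg_type) : Type :=
| Var of nat
| App (f : symb T) of 'I_(arity f) -> term T.

Fixpoint eval (T : alg_type) (A : algebra T) (e : nat -> A) (t : term T) : A :=
  match t with
  | Var n => e n
  | App f ts => oper (fun i => eval e (ts i))
  end.

Definition satisfies (T : alg_type) (A : algebra T) (Sigma : set (term T * term T)) :=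
  forall s t, Sigma (s, t) -> forall e : nat -> A, eval e s = eval e t.

Record valgebra (T : alg_type) (Sigma : set (term T * term T)) := VAlgebra {
  valg :> algebra T;
  valgP : satisfies valg Sigma }.

Definition is_hom (T : alg_type) (A B : algebra T) (h : A -> B) :=
  forall (f : symb T) (a : 'I_(arity f) -> A), h (oper a) = oper (fun i => h (a i)).

Definition is_iso (T : alg_type) (A B : algebra T) (h : A -> B) :=
  is_hom h /\ bijective h.

Definition op_closed (T : alg_type) (A : algebra T) (S : set A) :=
  forall (f : symb T) (a : 'I_(arity f) -> A), (forall i, S (a i)) -> S (oper a).

Record subalgebra (T : alg_type) (A : algebra T) := Subalgebra {
  sub_set : set A;
  sub_closed : op_closed sub_set }.

Definition sub_algebra (T : alg_type) (A : algebra T) (S : subalgebra A) : algebra T :=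
  @Algebra T {a : A | sub_set S a}
    (fun f a => exist _ (oper (fun i => sval (a i)))
                        (sub_closed (fun i => svalP (a i)))).

Coercion sub_algebra : subalgebra >-> algebra.

(* [theta x a = None] means that [theta x a] is undefined. *)
Record paction (G : groupType) (A : Type) := PAction {
  pact :> G -> A -> option A;
  pact1 : forall a, pact 1 a = Some a;
  pactV : forall x a b, pact x a = Some b -> pact x^-1 b = Some a;
  pactM : forall x y a b c,
    pact y a = Some b -> pact x b = Some c -> pact (x * y) a = Some c }.

Definition is_global (G : groupType) (A : Type) (theta : paction G A) :=
  forall x a, theta x a <> None.

Definition pdom (G : groupType) (A : Type) (theta : paction G A) (x : G) : set A :=
  [set b | exists a, theta x a = Some b].

Lemma pdomVP (G : groupType) (A : Type) (theta : paction G A) (x : G) (a : A) :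
  pdom theta x^-1 a <-> exists b, theta x a = Some b.
Proof.
split=> -[b tb]; last by exists b; apply: pactV.
by exists b; rewrite -[x]invgK; apply: pactV.
Qed.

Lemma pact_some (G : groupType) (A : Type) (theta : paction G A) (x z : G)
    (zE : z = x^-1) (a : A) :
  pdom theta z a -> theta x a = Some (odflt a (theta x a)).
Proof. by rewrite zE => /pdomVP[b ->]. Qed.

(* The bijection theta_x : D_z -> D_x for z = x^-1.  The equation is a
   parameter because the amalgam below needs z = x^-1 y against y^-1 x.
   The default of [odflt] is never used, see [pact_some]. *)
Definition pact_map (G : groupType) (A : Type) (theta : paction G A) (x z : G)
    (zE : z = x^-1) (s : {a | pdom theta z a}) : {b | pdom theta x b} :=
  exist _ (odflt (sval s) (theta x (sval s)))
          (ex_intro _ (sval s) (pact_some zE (svalP s))).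

Lemma pact_mapE (G : groupType) (A : Type) (theta : paction G A) (x z : G)
    (zE : z = x^-1) (s : {a | pdom theta z a}) :
  theta x (sval s) = Some (sval (pact_map zE s)).
Proof. by case: s => a Da; apply: (pact_some zE). Qed.

Record pA (G : groupType) (T : alg_type) (Sigma : set (term T * term T)) := MkPA {
  pA_alg :> valgebra Sigma;
  pA_act : paction G pA_alg;
  pA_closed : forall x, op_closed (pdom pA_act x);
  pA_dom := fun x => Subalgebra (@pA_closed x);
  pA_iso : forall x,
    @is_iso T (pA_dom x^-1) (pA_dom x) (pact_map (theta := pA_act) (erefl x^-1)) }.

Definition pA_morphism (G : groupType) (T : alg_type) (Sigma : set (term T * term T))
    (P Q : pA G Sigma) (phi : P -> Q) :=
  is_hom phi /\
  forall x a b, pA_act P x a = Some b -> pA_act Q x (phi a) = Some (phi b).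

Definition is_globalization (G : groupType) (T : alg_type)
    (Sigma : set (term T * term T)) (P Q : pA G Sigma) :=
  is_global (pA_act Q) /\
  exists iota : P -> Q,
    [/\ pA_morphism iota, injective iota &
        forall x a, pA_act P x a <> None <->
          exists2 c, pA_act Q x (iota a) = Some c & range iota c].

Record amalgam (T : alg_type) (Sigma : set (term T * term T)) (I : Type) := Amalgam {
  am_alg : I -> valgebra Sigma;
  am_sub : forall i j : I, subalgebra (am_alg i);
  am_map : forall i j : I, am_sub i j -> am_sub j i;
  am_iso : forall i j, is_iso (@am_map i j);
  am_mapK : forall i j, cancel (@am_map i j) (@am_map j i);
  am_sub_id : forall i, sub_set (am_sub i i) = setT;
  am_map_id : forall i (a : am_sub i i), am_map a = a }.

Definition embeddable (T : alg_type) (Sigma : set (term T * term T)) (I : Type)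
    (M : amalgam Sigma I) (C : valgebra Sigma) :=
  exists phi : forall i, am_alg M i -> C,
    [/\ forall i, is_hom (phi i),
        forall i, injective (phi i),
        forall i j (a : am_sub M i j), phi j (sval (am_map a)) = phi i (sval a) &
        forall i j,
          range (phi i) `&` range (phi j) = phi i @` sub_set (am_sub M i j)].

Section AssociatedAmalgam.
Variables (G : groupType) (T : alg_type) (Sigma : set (term T * term T)).
Variable P : pA G Sigma.

Lemma invg_mulV (x y : G) : x^-1 * y = (y^-1 * x)^-1.
Proof. by rewrite invgM invgK. Qed.

Definition assoc_sub (x y : G) : subalgebra P := pA_dom P (x^-1 * y).

(* alpha_{x,y} = theta_{y^-1 x} : D_{x^-1 y} -> D_{y^-1 x} *)
Definition assoc_map (x y : G) : assoc_sub x y -> assoc_sub y x :=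
  @pact_map G P (pA_act P) (y^-1 * x) (x^-1 * y) (invg_mulV x y).

Lemma assoc_iso x y : is_iso (@assoc_map x y).
Proof.
rewrite /assoc_map /assoc_sub; move: (invg_mulV x y).
by move: (x^-1 * y) => z zE; subst z; apply: pA_iso.
Qed.

Lemma assoc_mapK x y : cancel (@assoc_map x y) (@assoc_map y x).
Proof.
move=> a; apply: sval_inj => /=.
have e : pA_act P (y^-1 * x) (sval a) = Some (sval (assoc_map a)).
  exact: pact_mapE.
rewrite e /=; have -> // : pA_act P (x^-1 * y) (sval (assoc_map a)) = Some (sval a).
by rewrite [X in pA_act P X]invg_mulV; apply: pactV e.
Qed.

Lemma assoc_sub_id x : sub_set (assoc_sub x x) = setT.
Proof.
by apply/seteqP; split=> // a _; exists a; rewrite mulVg pact1.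
Qed.

Lemma assoc_map_id x (a : assoc_sub x x) : assoc_map a = a.
Proof. by case: a => a Da; apply: sval_inj; rewrite /= mulVg pact1. Qed.

Definition assoc_amalgam : amalgam Sigma G :=
  @Amalgam T Sigma G (fun=> P) assoc_sub assoc_map
    assoc_iso assoc_mapK assoc_sub_id assoc_map_id.

End AssociatedAmalgam.

(* Main.v *)
Require Import Defs.
From mathcomp Require Import all_boot.
From mathcomp Require Import boolp classical_sets.

(** Both directions rest on the same correspondence: inside a global algebra,
the translates [x . iota(A)] of the copy of [A] overlap exactly as the copies
[A_x] are glued in the amalgam.

If [iota] embeds [P] into a global [Q], put [phi_x(a) = x . iota(a)].  Each
[phi_x] is an injective homomorphism because translations of [Q] are; since
[x . iota(a) = y . iota(b)] says [y^-1 x . iota(a) = iota(b)], the globalization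
property identifies the intersection of the images of [phi_x] and [phi_y] with
the image under [phi_x] of [D_(x^-1 y)].

Conversely, let [phi_x : A -> C] embed the amalgam.  The algebra [C] carries no
action of [G], but the power [C^G], which is again in the variety, does: [G]
acts on it by automorphisms through [(g u)(h) = u (h g)].  The
map [iota(a) = (h |-> phi_h(a))] is an injective homomorphism, and the gluing
identity [phi_h (g a) = phi_(h g) (a)] is precisely equivariance of [iota].  If
[g iota(a) = iota(b)], evaluating at [h = 1] gives [phi_g(a) = phi_1(b)], a point
common to two images, so [a] lies in [D_(g^-1)] and [g a] is defined. *)

Set Implicit Arguments.
Unset Strict Implicit.
Unset Printing Implicit Defensive.

Local Open Scope classical_set_scope.
Local Open Scope group_scope.

(** * Partial actions by isomorphisms *)

Section PartialActions.
Variables (G : groupType) (T : alg_type) (Sigma : set (term T * term T)).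

(** Elementwise form of the homomorphism property of [theta_x], which frees it
from the subalgebra types [D_(x^-1)] and [D_x]. *)
Lemma pact_oper (P : pA G Sigma) x (f : symb T) (a b : 'I_(arity f) -> P) :
  (forall i, pA_act P x (a i) = Some (b i)) ->
  pA_act P x (oper a) = Some (oper b).
Proof.
move=> ab.
have Da i : pdom (pA_act P) x^-1 (a i) by apply/pdomVP; exists (b i).
have [homx _] := @pA_iso _ _ _ P x.
have /= e := congr1 (@proj1_sig _ _)
  (homx f (fun i => exist _ (a i) (Da i))).
have [c xc] : exists c, pA_act P x (oper a) = Some c.
  by apply/pdomVP; exact: (pA_closed Da).
move: e; rewrite xc /= => ->; congr (Some (oper _)).
by apply/funext => i; rewrite ab.
Qed.

(** Bijectivity of [theta_x : D_(x^-1) -> D_x] is automatic, the inverse being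
[theta_(x^-1)]; only compatibility with the operations has to be supplied. *)
Lemma pact_map_bij (A : Type) (theta : paction G A) x :
  bijective (pact_map (theta := theta) (erefl x^-1)).
Proof.
have bK (s : {b | pdom theta x b}) : exists a, theta x^-1 (sval s) = Some a.
  by case: s => b [a xa]; exists a; apply: pactV.
pose g s : {a | pdom theta x^-1 a} :=
  exist _ (sval (cid (bK s)))
    (ex_intro _ (sval s) (svalP (cid (bK s)))).
have gE s : theta x^-1 (sval s) = Some (sval (g s)) by exact: svalP (cid (bK s)).
exists g => s; apply: sval_inj.
  have := pactV (pact_mapE (erefl x^-1) s).
  by rewrite gE => -[].
have := pactV (gE s); rewrite invgK.
by rewrite (pact_mapE (erefl x^-1)) => -[].
Qed.

End PartialActions.

(** * From a globalization to an embedding of the amalgam *)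

Section GlobalToAmalgam.
Variables (G : groupType) (T : alg_type) (Sigma : set (term T * term T)).

Section Translations.
Variables (Q : pA G Sigma) (Qglobal : is_global (pA_act Q)).

Definition translate (x : G) (q : Q) : Q := odflt q (pA_act Q x q).

Lemma translateE x q : pA_act Q x q = Some (translate x q).
Proof. by rewrite /translate; case: (pA_act Q x q) (@Qglobal x q). Qed.

Lemma translateM x y q : translate x (translate y q) = translate (x * y) q.
Proof.
have := pactM (translateE y q) (translateE x (translate y q)).
by rewrite translateE => -[].
Qed.

Lemma translateK x : cancel (translate x) (translate x^-1).
Proof.
move=> q; have := pactV (translateE x q).
by rewrite translateE => -[].
Qed.

Lemma translate_hom x : is_hom (translate x).
Proof.
move=> f a; have := pact_oper (fun i => translateE x (a i)).
by rewrite translateE => -[].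
Qed.

End Translations.

Lemma globalization_embeddable (P Q : pA G Sigma) :
  is_globalization P Q -> embeddable (assoc_amalgam P) Q.
Proof.
move=> [Qglobal [iota [[iota_hom iota_act] iota_inj iota_dom]]].
have actE x a b : pA_act P x a = Some b -> translate x (iota a) = iota b.
  by move=> /iota_act; rewrite (translateE Qglobal) => -[].
have glue x y (a b : P) : pA_act P (y^-1 * x) a = Some b ->
    translate y (iota b) = translate x (iota a).
  by move=> /actE <-; rewrite translateM// mulgA mulgV mul1g.
exists (fun x (a : P) => translate x (iota a)); split=> /=.
- by move=> x f a; rewrite iota_hom translate_hom.
- by move=> x a b /(can_inj (translateK Qglobal x)) /iota_inj.
- by move=> x y a; exact: (glue _ _ _ _ (pact_mapE (invg_mulV x y) a)).
- move=> x y; apply/seteqP; split=> [_ [[a _ <-] [b _ xy]]|_ [a Da <-]].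
    exists a => //; rewrite /= invg_mulV; apply/pdomVP.
    have : pA_act P (y^-1 * x) a <> None.
      apply/iota_dom; exists (iota b); last by exists b.
      rewrite (translateE Qglobal) -(translateM Qglobal) -xy.
      by rewrite (translateK Qglobal).
    by case: (pA_act P _ a) => // c _; exists c.
  split; first by exists a.
  move: Da; rewrite /= invg_mulV => /pdomVP[b ab].
  by exists b => //; apply: glue.
Qed.

End GlobalToAmalgam.

(** * From an embedding of the amalgam to a globalization *)

Section PowerAlgebra.
Variables (T : alg_type) (Sigma : set (term T * term T)).
Variables (I : Type) (C : valgebra Sigma).

Definition power_alg : algebra T :=
  @Algebra T (I -> C) (fun f a i => oper (fun k => a k i)).

Lemma eval_power (e : nat -> power_alg) (t : term T) (i : I) :
  eval e t i = eval (fun n => e n i) t.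
Proof.
elim: t => [n //|f ts IH] /=; congr oper.
by apply/funext => k; apply: IH.
Qed.

Lemma power_satisfies : satisfies power_alg Sigma.
Proof.
move=> s t st e; apply/funext => i; rewrite !eval_power.
exact: valgP st _.
Qed.

Definition power : valgebra Sigma := VAlgebra power_satisfies.

End PowerAlgebra.

Section ShiftAction.
Variables (G : groupType) (T : alg_type) (Sigma : set (term T * term T)).
Variable C : valgebra Sigma.

(** Shifting the argument on the right by [g] makes this a left action. *)
Definition shift (g : G) (u : power G C) : power G C := fun h => u (h * g).

Lemma shiftM x y u : shift x (shift y u) = shift (x * y) u.
Proof. by apply/funext => h; rewrite /shift mulgA. Qed.

Lemma shift1 u : shift 1 u = u.
Proof. by apply/funext => h; rewrite /shift mulg1. Qed.

Definition shift_act : paction G (power G C).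
Proof.
exists (fun g u => Some (shift g u)).
- by move=> u; rewrite shift1.
- by move=> x u _ [<-]; rewrite shiftM mulVg shift1.
- by move=> x y u _ _ [<-] [<-]; rewrite shiftM.
Defined.

Lemma shift_dom x u : pdom shift_act x u.
Proof. by exists (shift x^-1 u); rewrite /= shiftM mulgV shift1. Qed.

Lemma shift_closed x : op_closed (A := power G C) (pdom shift_act x).
Proof. by move=> f a _; apply: shift_dom. Qed.

Lemma shift_iso x :
  @is_iso T (Subalgebra (@shift_closed x^-1)) (Subalgebra (@shift_closed x))
    (pact_map (theta := shift_act) (erefl x^-1)).
Proof.
split; last exact: pact_map_bij.
by move=> f a; apply: sval_inj.
Qed.

Definition shift_pA : pA G Sigma := MkPA shift_iso.

End ShiftAction.

Lemma embeddable_globalization (G : groupType) (T : alg_type)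
    (Sigma : set (term T * term T)) (P : pA G Sigma) (C : valgebra Sigma) :
  embeddable (assoc_amalgam P) C -> is_globalization P (shift_pA G C).
Proof.
move=> [phi [/= phi_hom phi_inj phi_glue phi_cap]]; split=> //.
(* The gluing of the copies of index [h * x] and [h], since
   [h^-1 * (h * x) = x]. *)
have phiM h x a b : pA_act P x a = Some b -> phi (h * x) a = phi h b.
  move=> ab; have Da : pdom (pA_act P) ((h * x)^-1 * h) a.
    by rewrite invgM -mulgA mulVg mulg1; apply/pdomVP; exists b.
  rewrite -(phi_glue (h * x) h (exist _ a Da)); congr (phi h _).
  by rewrite /= mulgA mulVg mul1g ab.
pose iota (a : P) : shift_pA G C := fun h => phi h a.
exists iota; split; first split.
- by move=> f a; apply/funext => h; apply: phi_hom.
- by move=> x a b ab; congr Some; apply/funext => h; apply: phiM.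
- by move=> a b /(congr1 (@^~ 1)); apply: phi_inj.
- move=> x a; split=> [|[_ [<-] [b _ ab]]].
    case ab: (pA_act P x a) => [b|] // _; exists (iota b); last by exists b.
    by congr Some; apply/funext => h; apply: phiM.
  have : (range (phi x) `&` range (phi 1)) (phi x a).
    split; first by exists a.
    by exists b => //; have /= := congr1 (@^~ 1) ab; rewrite /shift mul1g.
  rewrite phi_cap => -[a' Da' /phi_inj aa']; subst a'.
  by move: Da'; rewrite /= mulg1 => /pdomVP[c ->].
Qed.

Theorem theorem4p8 (G : groupType) (T : alg_type) (Sigma : set (term T * term T))
    (P : pA G Sigma) :
  (exists Q : pA G Sigma, is_globalization P Q) <->
  (exists C : valgebra Sigma, embeddable (assoc_amalgam P) C).
Proof.
split=> [[Q PQ]|[C PC]]; first by exists Q; apply: globalization_embeddable.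
by exists (shift_pA G C); apply: embeddable_globalization.
Qed.
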